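(* Let $K \subsetneq L$ be a field extension with at least one proper nontrivial intermediate field of finite $K$-dimension (that is, an intermediate field $F$ with $K\subsetneq F\subsetneq L$ and $[F:K]<\infty$). Let $n$ be a positive integer such that $$n_0(K,L) \leq n < [L:K].$$ Then there exist $n$-dimensional $K$-subspaces $A,B \subseteq L$ with $1 \notin B$ such that $(A,B)$ is an unmatchable pair if and only if there exists an intermediate extension $K \subsetneq F \subseteq L$ with $[F:K] \leq n$ and $[F:K] \nmid (n+1)$.
   Context: Let $K\subsetneq L$ be a field extension and let $A,B$ be $n$-dimensional $K$-subspaces of $L$ with $n>0$. For a subset $X$ of $L$, $\langle X\rangle$ denotes the $K$-subspace of $L$ spanned by $X$. An ordered basis $\{a_1,\ldots,a_n\}$ of $A$ is matched to an ordered basis $\{b_1,\ldots,b_n\}$ of $B$ if, for each $i\in\{1,\ldots,n\}$, $a_i^{-1}A\cap B\subseteq \langle b_1,\ldots,b_{i-1},b_{i+1},\ldots,b_n\rangle$. The subspace $A$ is matched to $B$ (equivalently, the pair $(A,B)$ is matchable) if every ordered basis of $A$ can be matched to some ordered basis of $B$; otherwise $(A,B)$ is unmatchable. For an intermediate field $F$ of $K\subseteq L$, $[F:K]$ denotes the $K$-dimension of $F$. The number $n_0(K,L)$ is the minimum of $[F:K]$ over all intermediate fields $K\subsetneq F\subseteq L$ with $[F:K]<\infty$. The degree $[L:K]$ may be infinite, in which case the condition $n<[L:K]$ holds for every integer $n$. *)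

(* Defs.v *)
From HB Require Import structures.
From mathcomp Require Import all_boot all_order all_algebra.
From mathcomp Require Import boolp classical_sets.

Set Implicit Arguments.
Unset Strict Implicit.
Unset Printing Implicit Defensive.

Import GRing.Theory.
Local Open Scope classical_set_scope.
Local Open Scope ring_scope.

(* A field extension of arbitrary (possibly infinite) degree is an embedding  *)
(* iota : K -> L; the base field inside L is [range iota].  MathComp's        *)
(* fieldExtType is not used because it forces [L:K] to be finite.             *)
Section FieldExtension.
Variables (K L : fieldType) (iota : {rmorphism K -> L}).

Definition kspan (X : set L) : set L :=
  [set x | exists (m : nat) (c : 'I_m -> K) (v : 'I_m -> L),
     (forall i, X (v i)) /\ x = \sum_(i < m) iota (c i) * v i].

Definition kfree n (v : 'I_n -> L) : Prop :=
  forall c : 'I_n -> K, \sum_(i < n) iota (c i) * v i = 0 -> forall i, c i = 0.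

Definition kbasis n (v : 'I_n -> L) (A : set L) : Prop :=
  kfree v /\ kspan (range v) = A.

(* "A is a K-subspace of L of finite dimension n"; being a subspace is part   *)
(* of having a basis.                                                         *)
Definition kdim (A : set L) (n : nat) : Prop :=
  exists v : 'I_n -> L, kbasis v A.

Definition matched_bases n (A B : set L) (a b : 'I_n -> L) : Prop :=
  forall i : 'I_n,
    [set (a i)^-1 * x | x in A] `&` B `<=` kspan [set b j | j in [set j | j != i]].

Definition matched (A B : set L) : Prop :=
  forall n (a : 'I_n -> L), kbasis a A ->
    exists b : 'I_n -> L, kbasis b B /\ matched_bases A B a b.

Definition intermediate_field (F : set L) : Prop :=
  range iota `<=` F /\ divring_closed [in F].

Definition finite_degrees : set nat :=
  [set d | exists F : set L,
     [/\ intermediate_field F, range iota `<` F & kdim F d]].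

(* n_0(K, L); the value 0 is taken only when finite_degrees is empty.         *)
Definition n0 : nat :=
  xget 0%N [set m | finite_degrees m /\
                    forall d, finite_degrees d -> (m <= d)%N].

(* n < [L:K]; vacuously true when L has infinite dimension over K.            *)
Definition lt_degree (n : nat) : Prop :=
  forall d, kdim [set: L] d -> (n < d)%N.

End FieldExtension.

(* Main.v *)
(* Not matchable means, by a linear Hall theorem, that [S U <= A] for some
   [S <= A] and [U <= B] with [dim S + dim U > n].  Adjoining [1] to [U] and
   applying Dyson transforms until [U] stabilises [S] yields [V <= A] whose
   stabiliser is a field [H] with [dim V + [H:K] >= n + 2]; as [[H:K]] divides
   [dim V <= n], it cannot divide [n + 1].  Conversely, if [n = q d + r] with
   [d = [F:K]] and [r < d - 1], take for [A] an extension of an [F]-space [V] of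
   [K]-dimension [q d] and for [B] an extension of a complement [U] of [K] in
   [F]: then [V U <= A] and [dim V + dim U > n]. *)

Require Import Defs.
From HB Require Import structures.
From mathcomp Require Import all_boot all_order all_algebra.
From mathcomp Require Import boolp classical_sets.
From mathcomp Require Import zify.

Set Implicit Arguments.
Unset Strict Implicit.
Unset Printing Implicit Defensive.

Import GRing.Theory.
Local Open Scope classical_set_scope.
Local Open Scope ring_scope.

(** * Linear algebra in finite dimension: a dual Rado theorem *)

(** If no [U] equals [P], every subspace inside [P] can be enlarged by a vector of [P], so subspaces
    of unbounded dimension appear. *)
Lemma vspace_of_set (K : fieldType) (vT : vectType K) (P : set vT) :
    P 0 -> (forall c x y, P x -> P y -> P (c *: x + y)) ->
  exists U : {vspace vT}, forall x, x \in U <-> P x.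
Proof.
move=> P0 Plin; apply: contrapT => noU.
suff big k : exists U : {vspace vT}, (forall x, x \in U -> P x) /\ (k <= \dim U)%N.
  have [U [_ /leq_trans/(_ (dimvS (subvf U)))]] := big (\dim (fullv : {vspace vT})).+1.
  by rewrite ltnn.
elim: k => [|k [U [UP kU]]].
  by exists 0%VS; split=> // x; rewrite memv0 => /eqP ->.
have [x [Px xU]] : exists x, P x /\ x \notin U.
  apply: contrapT => nox; apply: noU; exists U => x; split=> [/UP//|Px].
  by apply: contrapT => /negP xU; apply: nox; exists x.
exists (U + <[x]>)%VS; split=> [y /memv_addP[u uU [w /vlineP[c ->] ->]]|].
  by rewrite addrC; apply: Plin => //; apply: UP.
rewrite (leq_ltn_trans kU) // ltnNge; apply: contra xU => dimU.
have/eqP-> : U == (U + <[x]>)%VS by rewrite eqEdim addvSl.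
by rewrite memvE addvSr.
Qed.

(** Uncrossing: [W i] is the intersection of two strictly larger spaces [P] and [Q]. If neither can
    replace [W i], each violates the rank condition at some index set; the dimension formula for sum
    and intersection then contradicts the condition at the meet of these two sets and at their union
    with [i] added. *)
Lemma dual_rado_enlarge (K : fieldType) (vT : vectType K) n
    (W : 'I_n -> {vspace vT}) (i : 'I_n) :
    (forall J : {set 'I_n}, \dim (\bigcap_(j in J) W j) + #|J| <= \dim {:vT})%N ->
    (\dim (W i) + 1 < \dim {:vT})%N ->
  exists P : {vspace vT}, [/\ (W i <= P)%VS, (\dim (W i) < \dim P)%N &
   forall J : {set 'I_n},
   (\dim (\bigcap_(j in J) (if j == i then P else W j)) + #|J| <= \dim {:vT})%N].
Proof.
move=> hall dimWi; apply: contrapT => noP.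
have [|x _ xW] := subvPn (_ : ~~ ({:vT} <= W i)%VS).
  by apply/negP => /dimvS; lia.
set P := (W i + <[x]>)%VS; set Q := (W i + P^C)%VS.
have WP : (W i <= P)%VS := addvSl _ _.
have WQ : (W i <= Q)%VS := addvSl _ _.
have PQ : (Q :&: P = W i)%VS.
  by rewrite -vspace_modl // [(_ :&: P)%VS]capvC capv_compl addv0.
have dimWP : (\dim (W i) < \dim P)%N.
  rewrite ltnNge; apply: contra xW => dimP.
  by have/eqP-> : W i == P by [rewrite eqEdim WP]; rewrite memvE addvSr.
have dimP : (\dim P <= \dim (W i) + 1)%N.
  apply: leq_trans (dimv_add_leqif _ _) _.
  by rewrite leq_add2l dim_vline leq_b1.
(* Here codimension at least 2 enters: [P] is not the whole space, so [P^C] is nonzero and really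
   enlarges [W i]. *)
have dimWQ : (\dim (W i) < \dim Q)%N.
  rewrite ltnNge; apply/negP => dimQ.
  have/eqP QW : W i == Q by rewrite eqEdim WQ.
  have: (P^C <= P :&: P^C)%VS.
    by rewrite subv_cap subvv andbT (subv_trans _ WP) // QW addvSr.
  by rewrite capv_compl => /dimvS; rewrite dimv0 dimv_compl; lia.
(* A violating set must contain [i], since the others do not see the replacement. Removing [i] turns
   the strict inequality into the weak one stated here. *)
have fails (R : {vspace vT}) : (W i <= R)%VS -> (\dim (W i) < \dim R)%N ->
    exists2 J : {set 'I_n}, i \notin J &
    (\dim {:vT} <= \dim (R :&: \bigcap_(j in J) W j) + #|J|)%N.
  move=> WR dimR; apply: contrapT => noJ; apply: noP; exists R; split=> // J.
  rewrite leqNgt; apply/negP => bigJ; apply: noJ.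
  have WJ (J' : {set 'I_n}) : i \notin J' ->
      (\bigcap_(j in J') (if j == i then R else W j) = \bigcap_(j in J') W j)%VS.
    by move=> iJ'; apply: eq_bigr => j jJ'; case: eqP => // ji;
      rewrite ji (negPf iJ') in jJ'.
  have [iJ|iJ] := boolP (i \in J); last by move: bigJ; rewrite WJ // ltnNge hall.
  exists (J :\ i); first by rewrite !inE eqxx.
  move: bigJ; rewrite (big_setD1 i iJ) /= eqxx WJ ?inE ?eqxx //.
  by rewrite (cardsD1 i J) iJ add1n addnS ltnS.
have [J iJ dimJ] := fails P WP dimWP; have [J' iJ' dimJ'] := fails Q WQ dimWQ.
pose X (J : {set 'I_n}) := (\bigcap_(j in J) W j)%VS.
have XS (J1 J2 : {set 'I_n}) : J1 \subset J2 -> (X J2 <= X J1)%VS.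
  by move=> J12; apply/subv_bigcapP => j jJ; apply: (bigcapv_inf j);
    [exact: (fintype.subsetP J12)|exact: subvv].
have sumX : (P :&: X J + Q :&: X J' <= X (J :&: J')%SET)%VS.
  rewrite subv_add !(subv_trans (capvSr _ _)) //.
    by apply: XS; exact: subsetIr.
  by apply: XS; exact: subsetIl.
have capX : ((P :&: X J) :&: (Q :&: X J') <= X (i |: (J :|: J'))%SET)%VS.
  apply/subvP => y; rewrite !memv_cap => /andP[/andP[yP yJ] /andP[yQ yJ']].
  rewrite memvE; apply/subv_bigcapP => j; rewrite !inE => /or3P[/eqP->|jJ|jJ].
  - by rewrite -memvE -PQ memv_cap yQ.
  - by apply: subv_trans yJ _; apply: (bigcapv_inf j); rewrite ?subvv.
  - by apply: subv_trans yJ' _; apply: (bigcapv_inf j); rewrite ?subvv.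
have := dimv_sum_cap (P :&: X J) (Q :&: X J').
have := hall (J :&: J'); have := hall (i |: (J :|: J')).
rewrite cardsU1 !inE negb_or iJ iJ' -/(X _) -/(X _).
have := dimvS sumX; have := dimvS capX; have := cardsUI J J'.
rewrite /X in dimJ dimJ' *; lia.
Qed.

(* The dual form of Rado's theorem on linearly independent transversals:
   enlarge the [W i] to hyperplanes without breaking the rank condition; the
   hyperplanes then meet in 0, so they are the coordinate hyperplanes of a
   basis. *)
Lemma dual_rado (K : fieldType) (vT : vectType K) n
    (W : 'I_n -> {vspace vT}) :
    \dim {:vT} = n ->
    (forall J : {set 'I_n}, \dim (\bigcap_(j in J) W j) + #|J| <= \dim {:vT})%N ->
  exists2 b : n.-tuple vT, basis_of {:vT} b &
    forall i x, x \in W i -> coord b i x = 0.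
Proof.
move=> dimT.
(* Induction on the total codimension of the [W i]. *)
have [m le_m] := ubnP (\sum_i (\dim {:vT} - \dim (W i)))%N.
elim: m W le_m => // m IH W le_m hall.
have [[i dimWi]|noi] := pselect (exists i, \dim (W i) + 1 < \dim {:vT})%N.
  have [P [WP dimP hallP]] := dual_rado_enlarge hall dimWi.
  have [|b bb bW] := IH _ _ hallP.
    rewrite -ltnS; apply: leq_trans le_m; rewrite ltnS (bigD1 i) //=.
    rewrite [X in (_ <= X)%N](bigD1 i) //= eqxx.
    rewrite -addSn leq_add //; first by have := dimvS (subvf P); lia.
    by apply: leq_sum => j /negPf->.
  exists b => // j x xW; apply: bW; case: eqP => // ji.
  by rewrite ji in xW; move: x xW; apply/subvP.
have dimW i : (\dim {:vT} <= \dim (W i) + 1)%N.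
  by rewrite leqNgt; apply/negP => ?; apply: noi; exists i.
(* Every [W i] now has codimension at most 1, so intersecting [#|J|] of them costs at most [#|J|]
   dimensions. *)
have dimX (J : {set 'I_n}) : (n <= \dim (\bigcap_(j in J) W j) + #|J|)%N.
  have [k] := ubnP #|J|; elim: k J => // k IHk J.
  have [->|[i iJ]] := set_0Vmem J; first by rewrite big_set0 dimT leq_addr.
  rewrite (cardsD1 i J) iJ add1n ltnS => /IHk.
  set X := (\bigcap_(j in _) _)%VS => dimX.
  have -> : (\bigcap_(j in J) W j = W i :&: X)%VS by rewrite (big_setD1 i iJ).
  have := dimv_sum_cap (W i) X; have := dimvS (subvf (W i + X)%VS).
  by have := dimW i; lia.
(* [b i] is a nonzero vector common to all [W j] with [j != i]; it avoids [W i] because the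
   condition at the full index set makes the total intersection 0. *)
have [b bP] : exists b : 'I_n -> vT, forall i j, (b i \in W j) = (j != i).
  suff/(_ _)/cid-/all_sig[b bP] : forall i, exists x, forall j, (x \in W j) = (j != i).
    by exists b.
  move=> i; set X := (\bigcap_(j in [set~ i]%SET) W j)%VS.
  have capX : (W i :&: X = 0)%VS.
    apply/eqP; rewrite -dimv_eq0; have := hall (finset.setTfor 'I_n).
    rewrite cardsT card_ord.
    have -> : (\bigcap_(j in finset.setTfor 'I_n) W j = W i :&: X)%VS.
      by rewrite (big_setD1 i) ?finset.in_setT // finset.setTD.
    by rewrite dimT; lia.
  have X0 : X != 0%VS.
    rewrite -dimv_eq0; have := dimX [set~ i]%SET; rewrite -/X cardsC1 card_ord.
    by have := ltn_ord i; lia.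
  exists (vpick X) => j; case: eqVneq => [->|ji].
    apply/negP => bW; move: X0; rewrite -vpick0 -memv0 -capX memv_cap bW.
    by rewrite memv_pick.
  have := memv_pick X; move: (vpick X); apply/subvP.
  by apply: (bigcapv_inf j); rewrite ?subvv ?inE.
(* In a relation with nonzero coefficient at [i], all other terms lie in [W i], which would force
   [b i] into [W i]. The same argument later kills the [i]-th coordinate on [W i]. *)
have bfree : free [tuple b i | i < n].
  apply/freeP => c; under eq_bigr do rewrite -tnth_nth tnth_mktuple.
  move=> c0 i; apply: contrapT => /eqP ci.
  have: b i \in W i; last by rewrite bP eqxx.
  rewrite -[b i](scalerK ci) memvZ //.
  move: c0; rewrite (bigD1 i) //= => /eqP; rewrite addr_eq0 => /eqP->.
  rewrite memvN memv_suml // => j ji; by rewrite memvZ // bP eq_sym.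
have bbasis : basis_of {:vT} [tuple b i | i < n].
  by rewrite basisEfree bfree subvf size_tuple dimT leqnn.
exists [tuple b i | i < n] => // i x xW; apply: contrapT => /eqP xi.
have: b i \in W i; last by rewrite bP eqxx.
rewrite -[b i](scalerK xi) memvZ //.
have := coord_basis bbasis (memvf x); rewrite (bigD1 i) //.
rewrite -tnth_nth tnth_mktuple => /eqP; rewrite -subr_eq => /eqP <-.
rewrite memvB // memv_suml // => j ji.
by rewrite -tnth_nth tnth_mktuple memvZ // bP eq_sym.
Qed.

Lemma exists_basis (K : fieldType) (vT : vectType K) (U : {vspace vT}) n :
  \dim U = n -> exists X : n.-tuple vT, basis_of U X.
Proof. by move=> <-; exists (vbasis U); apply: vbasisP. Qed.

(** * Finite-dimensional [K]-subspaces of [L] through coordinates *)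

Section Subspaces.
Variables (K L : fieldType) (iota : {rmorphism K -> L}).
Implicit Types (W E F : set L) (x y z : L).

Definition kspace W := W 0 /\ forall c x y, W x -> W y -> W (iota c * x + y).

(** The linear map from coordinate rows to [L] given by the family [v]. Since [L] may have infinite
    degree, its finite-dimensional subspaces are handled as subspaces of ['rV[K]_n] pulled back
    along such maps. *)
Definition lc n (v : 'I_n -> L) (c : 'rV[K]_n) : L :=
  \sum_(i < n) iota (c 0 i) * v i.

Lemma lc_lin n (v : 'I_n -> L) a c d :
  lc v (a *: c + d) = iota a * lc v c + lc v d.
Proof.
rewrite /lc mulr_sumr -big_split; apply: eq_bigr => i _ /=.
by rewrite !mxE rmorphD rmorphM mulrDl mulrA.
Qed.

Lemma lc0 n (v : 'I_n -> L) : lc v 0 = 0.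
Proof. by rewrite /lc big1 // => i _; rewrite mxE rmorph0 mul0r. Qed.

Lemma lcZ n (v : 'I_n -> L) a c : lc v (a *: c) = iota a * lc v c.
Proof. by have := lc_lin v a c 0; rewrite lc0 !addr0. Qed.

Lemma lcD n (v : 'I_n -> L) c d : lc v (c + d) = lc v c + lc v d.
Proof. by have := lc_lin v 1 c d; rewrite scale1r rmorph1 mul1r. Qed.

Lemma lcN n (v : 'I_n -> L) c : lc v (- c) = - lc v c.
Proof. by rewrite -scaleN1r lcZ rmorphN rmorph1 mulN1r. Qed.

Lemma lc_sum n (v : 'I_n -> L) I (r : seq I) (P : pred I) (F : I -> 'rV[K]_n) :
  lc v (\sum_(i <- r | P i) F i) = \sum_(i <- r | P i) lc v (F i).
Proof. exact: (big_morph (lc v) (lcD v) (lc0 v)). Qed.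

Lemma lc_delta n (v : 'I_n -> L) i : lc v (delta_mx 0 i) = v i.
Proof.
rewrite /lc (bigD1 i) //= mxE !eqxx rmorph1 mul1r big1 ?addr0 // => j ji.
by rewrite mxE (negPf ji) andbF rmorph0 mul0r.
Qed.

Lemma kfree_lc n (v : 'I_n -> L) : kfree iota v <-> forall c, lc v c = 0 -> c = 0.
Proof.
split=> [fv c /fv c0|fv c c0 i]; first by apply/rowP => i; rewrite mxE.
have/rowP/(_ i) : \row_i c i = 0 :> 'rV_n.
  by apply: fv; rewrite -[RHS]c0; apply: eq_bigr => j _; rewrite mxE.
by rewrite !mxE.
Qed.

Lemma kspaceD W x y : kspace W -> W x -> W y -> W (x + y).
Proof. by move=> [_ lW] Wx Wy; have := lW 1 _ _ Wx Wy; rewrite rmorph1 mul1r. Qed.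

Lemma kspaceZ W c x : kspace W -> W x -> W (iota c * x).
Proof. by move=> [W0 lW] Wx; have := lW c _ _ Wx W0; rewrite addr0. Qed.

Lemma kspaceN W x : kspace W -> W x -> W (- x).
Proof. by move=> kW /(kspaceZ (-1) kW); rewrite rmorphN rmorph1 mulN1r. Qed.

Lemma kspaceB W x y : kspace W -> W x -> W y -> W (x - y).
Proof. by move=> kW Wx Wy; apply: kspaceD => //; apply: kspaceN. Qed.

Lemma kspace_sum W I (r : seq I) (P : pred I) (f : I -> L) : kspace W ->
  (forall i, P i -> W (f i)) -> W (\sum_(i <- r | P i) f i).
Proof. by move=> kW Wf; apply: big_ind => //; [case: kW|move=> *; apply: kspaceD]. Qed.

Lemma kspace_lc W n (v : 'I_n -> L) c : kspace W ->
  (forall i, W (v i)) -> W (lc v c).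
Proof. by move=> kW Wv; apply: kspace_sum => // i _; apply: kspaceZ. Qed.

Lemma kspace_range n (v : 'I_n -> L) : kspace (range (lc v)).
Proof.
split; first by exists 0; rewrite ?lc0.
by move=> c _ _ [x _ <-] [y _ <-]; exists (c *: x + y); rewrite ?lc_lin.
Qed.

Lemma kspan_min W X : kspace W -> X `<=` W -> kspan iota X `<=` W.
Proof.
move=> kW XW _ [m [c [v [Xv ->]]]]; apply: kspace_sum => // i _.
by apply: kspaceZ => //; apply: XW.
Qed.

Lemma sub_kspan X : X `<=` kspan iota X.
Proof.
move=> x Xx; exists 1%N, (fun=> 1), (fun=> x); split=> //.
by rewrite big_ord1 rmorph1 mul1r.
Qed.

Lemma kspace_kspan X : kspace (kspan iota X).
Proof.
split; first by exists 0%N, (fun=> 0), (fun=> 0); rewrite big_ord0; split=> // -[].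
move=> a x y [m [c [v [Xv ->]]]] [p [d [w [Xw ->]]]].
exists (m + p)%N, (fun i => match split i with inl j => a * c j | inr j => d j end).
exists (fun i => match split i with inl j => v j | inr j => w j end).
split=> [i|]; first by case: (split i).
rewrite big_split_ord mulr_sumr; congr (_ + _); apply: eq_bigr => i _.
  by rewrite (unsplitK (inl i)) rmorphM mulrA.
by rewrite (unsplitK (inr i)).
Qed.

Lemma kspan_range n (v : 'I_n -> L) : kspan iota (range v) = range (lc v).
Proof.
apply/seteqP; split.
  apply: kspan_min; first exact: kspace_range.
  by move=> _ [i _ <-]; exists (delta_mx 0 i); rewrite ?lc_delta.
move=> _ [c _ <-]; apply: kspace_lc; first exact: kspace_kspan.
by move=> i; apply: sub_kspan; exists i.
Qed.

Lemma kbasis_lc n (v : 'I_n -> L) W :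
  kbasis iota v W <-> (forall c, lc v c = 0 -> c = 0) /\ range (lc v) = W.
Proof. by rewrite /kbasis kspan_range kfree_lc. Qed.

Lemma kdim_kspace W n : kdim iota W n -> kspace W.
Proof. by move=> [v /kbasis_lc[_ <-]]; apply: kspace_range. Qed.

(** Transfers bases from coordinate space to [L]. Injectivity is asked on [U] only, which also
    covers families [v] that are not free. *)
Lemma kbasis_image m n (v : 'I_m -> L) (U : {vspace 'rV[K]_m})
    (X : n.-tuple 'rV[K]_m) :
    (forall c, c \in U -> lc v c = 0 -> c = 0) -> basis_of U X ->
  kbasis iota (fun i => lc v (tnth X i)) (lc v @` [set` U]).
Proof.
move=> injv bX.
have lcX c : lc (fun i => lc v (tnth X i)) c = lc v (\sum_i c 0 i *: X`_i).
  by rewrite lc_sum; apply: eq_bigr => i _; rewrite lcZ (tnth_nth 0).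
have memX (c : 'rV[K]_n) : \sum_(i < n) c 0 i *: X`_i \in U.
  by apply: memv_suml => i _; rewrite memvZ // (basis_mem bX) // mem_nth ?size_tuple.
apply/kbasis_lc; split=> [c|].
  rewrite lcX => /(injv _ (memX c)) c0; apply/rowP => i.
  by have /freeP/(_ (c 0) c0 i) := basis_free bX; rewrite mxE.
apply/seteqP; split=> _ [c cU <-].
  by exists (\sum_i c 0 i *: X`_i); rewrite ?lcX //=; apply: memX.
exists (\row_i coord X i c) => //; rewrite lcX; congr lc.
rewrite {2}(coord_basis bX cU); apply: eq_bigr => i _; by rewrite mxE.
Qed.

Lemma kdim_image m (v : 'I_m -> L) (U : {vspace 'rV[K]_m}) :
    (forall c, c \in U -> lc v c = 0 -> c = 0) ->
  kdim iota (lc v @` [set` U]) (\dim U).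
Proof. by move=> injv; eexists; apply: kbasis_image injv (vbasisP U). Qed.

Lemma preim_kspace m (v : 'I_m -> L) W : kspace W ->
  exists U : {vspace 'rV[K]_m}, forall c, c \in U <-> W (lc v c).
Proof.
move=> [W0 lW]; apply: vspace_of_set; first by rewrite lc0.
by move=> a c d Wc Wd; rewrite lc_lin; apply: lW.
Qed.

Lemma image_preim m (v : 'I_m -> L) W (U : {vspace 'rV[K]_m}) :
    W `<=` range (lc v) -> (forall c, c \in U <-> W (lc v c)) ->
  lc v @` [set` U] = W.
Proof.
move=> Wv UP; apply/seteqP; split=> [_ [c /UP cW <-] //|x Wx].
by have [c _ cx] := Wv x Wx; exists c => //=; apply/UP; rewrite cx.
Qed.

(** The coordinates over [v] of a basis of [W] form an [n] by [m] matrix with independent rows. *)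
Lemma kdim_le_range m n (v : 'I_m -> L) W :
  kdim iota W n -> W `<=` range (lc v) -> (n <= m)%N.
Proof.
move=> [w /kbasis_lc[fw defW]] Wv.
have /choice[C CP] : forall i, exists c, w i = lc v c.
  move=> i; have [|c _ <-] := Wv (w i); last by exists c.
  by rewrite -defW; exists (delta_mx 0 i); rewrite ?lc_delta.
have: row_free (\matrix_i C i).
  rewrite -kermx_eq0; apply/eqP/row_matrixP => i; rewrite row0; apply: fw.
  set u := row i _.
  have: u *m (\matrix_i C i) = 0 by rewrite -row_mul mulmx_ker row0.
  rewrite mulmx_sum_row => u0.
  transitivity (lc v (\sum_j u 0 j *: row j (\matrix_i C i))).
  2: by rewrite u0 lc0.
  by rewrite lc_sum; apply: eq_bigr => j _; rewrite lcZ rowK CP.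
by rewrite /row_free => /eqP <-; rewrite rank_leq_col.
Qed.

Lemma kdim_leq m n W E :
  kdim iota W m -> kdim iota E n -> W `<=` E -> (m <= n)%N.
Proof. by move=> dW [e /kbasis_lc[_ <-]]; apply: kdim_le_range. Qed.

Lemma kdim_uniq m n W : kdim iota W m -> kdim iota W n -> m = n.
Proof. by move=> dm dn; apply/eqP; rewrite eqn_leq !(kdim_leq (E := W) (W := W)). Qed.

Lemma kspace_sub_kdim n W E : kspace W -> kdim iota E n -> W `<=` E ->
  exists m, kdim iota W m.
Proof.
move=> kW [e /kbasis_lc[fe defE]] WE; have [U UP] := preim_kspace e kW.
exists (\dim U); rewrite -(image_preim _ UP) ?defE //.
by apply: kdim_image => c _; apply: fe.
Qed.

(** A complement of the kernel of [lc v] maps isomorphically onto the span. *)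
Lemma kdim_range n (v : 'I_n -> L) : exists m, kdim iota (range (lc v)) m.
Proof.
have [N NP] : exists U : {vspace 'rV[K]_n}, forall c, c \in U <-> lc v c = 0.
  apply: (preim_kspace v (W := [set 0])); split=> // c x y -> ->.
  by rewrite mulr0 addr0.
exists (\dim N^C); suff -> : range (lc v) = lc v @` [set` N^C%VS].
  apply: kdim_image => c cC /NP cN; apply/eqP.
  by rewrite -memv0 -(capv_compl N) memv_cap cN.
apply/seteqP; split=> _ [c _ <-]; last by exists c.
have: c \in (N + N^C)%VS by rewrite addv_complf memvf.
move=> /memv_addP[u /NP uN [w wC ->]]; exists w => //.
by rewrite lcD uN add0r.
Qed.

(** * Sums, intersections and multiples of subspaces, with their dimensions *)

Definition sumset W E := [set z | exists x y, [/\ W x, E y & z = x + y]].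

Lemma kspaceI W E : kspace W -> kspace E -> kspace (W `&` E).
Proof.
move=> [W0 lW] [E0 lE]; split=> // c x y [Wx Ex] [Wy Ey].
by split; [apply: lW|apply: lE].
Qed.

Lemma sumset_subl W E : kspace E -> W `<=` sumset W E.
Proof. by move=> [E0 _] x Wx; exists x, 0; rewrite addr0. Qed.

Lemma sumset_subr W E : kspace W -> E `<=` sumset W E.
Proof. by move=> [W0 _] x Wx; exists 0, x; rewrite add0r. Qed.

(** Two concatenated bases span the sum, so it has a finite basis [f]; in the coordinates of [f] the
    claim is the dimension formula for [{vspace _}]. *)
Lemma kdim_sumI a b W E : kdim iota W a -> kdim iota E b ->
  exists s t,
    [/\ kdim iota (sumset W E) s, kdim iota (W `&` E) t & (s + t = a + b)%N].
Proof.
move=> dW dE; have kW := kdim_kspace dW; have kE := kdim_kspace dE.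
have [s dS] : exists s, kdim iota (sumset W E) s.
  have [w /kbasis_lc[_ defW]] := dW; have [e /kbasis_lc[_ defE]] := dE.
  pose v (i : 'I_(a + b)) := match split i with inl j => w j | inr j => e j end.
  have [s] := kdim_range v; exists s; suff <- : range (lc v) = sumset W E by [].
  have vl i : v (lshift b i) = w i by rewrite /v (unsplitK (inl i)).
  have vr i : v (rshift a i) = e i by rewrite /v (unsplitK (inr i)).
  have lcv c d : lc v (row_mx c d) = lc w c + lc e d.
    by rewrite /lc big_split_ord; congr (_ + _); apply: eq_bigr => i _;
      rewrite ?row_mxEl ?row_mxEr ?vl ?vr.
  apply/seteqP; split=> [_ [c _ <-]|z [x [y []]]].
    rewrite -[c]hsubmxK lcv; exists (lc w (lsubmx c)), (lc e (rsubmx c)).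
    by split=> //; [rewrite -defW; exists (lsubmx c)|
      rewrite -defE; exists (rsubmx c)].
  rewrite -defW -defE => -[c _ <-] [d _ <-] ->.
  by exists (row_mx c d); rewrite ?lcv.
have kI := kspaceI kW kE.
have [f /kbasis_lc[ff defS]] := dS.
have [U UP] := preim_kspace f kW; have [V VP] := preim_kspace f kE.
have img (X : set L) (Y : {vspace 'rV[K]_s}) : X `<=` sumset W E ->
    (forall c, c \in Y <-> X (lc f c)) -> kdim iota X (\dim Y).
  move=> XS YP; rewrite -(image_preim _ YP) ?defS //.
  by apply: kdim_image => c _; apply: ff.
exists s, (\dim (U :&: V)); split=> //.
  apply: img => [x [Wx _]|c]; first exact: sumset_subl.
  rewrite memv_cap; split=> [/andP[/UP ? /VP ?] //|[/UP-> /VP->] //].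
rewrite (kdim_uniq dW (img W U (@sumset_subl W E kE) UP)).
rewrite (kdim_uniq dE (img E V (@sumset_subr W E kW) VP)).
rewrite -dimv_sum_cap; congr (_ + _)%N.
suff -> : (U + V = fullv)%VS by rewrite dimvf /dim /= mul1n.
apply/eqP; rewrite eqEsubv subvf; apply/subvP => c _.
have : sumset W E (lc f c) by rewrite -defS; exists c.
move=> [x [y [Wx Ey cxy]]].
have: sumset W E x by apply: sumset_subl.
have: sumset W E y by apply: sumset_subr.
rewrite -defS => -[d _ dy] [e _ ex].
have -> : c = e + d.
  by apply/eqP; rewrite -subr_eq0; apply/eqP/ff; rewrite lcD lcN lcD cxy dy ex subrr.
by apply: memv_add; [apply/UP; rewrite ex|apply/VP; rewrite dy].
Qed.

Lemma kdim_eq n W E : kdim iota W n -> kdim iota E n -> W `<=` E -> W = E.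
Proof.
move=> dW [e /kbasis_lc[fe defE]] WE.
have [U UP] := preim_kspace e (kdim_kspace dW).
have defW : lc e @` [set` U] = W by apply: image_preim; rewrite ?defE.
have dU : kdim iota W (\dim U) by rewrite -defW; apply: kdim_image => c _; apply: fe.
have/eqP fU : U == fullv.
  by rewrite eqEdim subvf dimvf (kdim_uniq dU dW) /dim /= mul1n.
by rewrite -defW -defE; congr image; apply/seteqP; split=> // c _; rewrite /= fU memvf.
Qed.

Definition scaleset e W := [set e * x | x in W].

Lemma kdim_scale n e W : e != 0 -> kdim iota W n -> kdim iota (scaleset e W) n.
Proof.
move=> e0 [w /kbasis_lc[fw <-]]; exists (fun i => e * w i); apply/kbasis_lc.
have lce c : lc (fun i => e * w i) c = e * lc w c.
  by rewrite /lc mulr_sumr; apply: eq_bigr => i _; rewrite mulrCA.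
split=> [c|].
  by rewrite lce => /eqP; rewrite mulf_eq0 (negPf e0) => /eqP; apply: fw.
apply/seteqP; split=> [_ [c _ <-]|_ [_ [c _ <-] <-]].
  by exists (lc w c); rewrite ?lce //; exists c.
by exists c; rewrite ?lce.
Qed.

Lemma kdim0 : kdim iota [set 0] 0.
Proof.
exists (fun=> 0); apply/kbasis_lc; split=> [c _|]; first by apply/rowP => -[].
apply/seteqP; split=> [_ [c _ <-]|_ ->]; first by rewrite /lc big_ord0.
by exists 0; rewrite ?lc0.
Qed.

Lemma kdim_sum_direct a b W E : kdim iota W a -> kdim iota E b ->
  W `&` E `<=` [set 0] -> kdim iota (sumset W E) (a + b).
Proof.
move=> dW dE WE0; have [s [t [dS dI <-]]] := kdim_sumI dW dE.
suff -> : t = 0%N by rewrite addn0.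
by apply/eqP; rewrite -leqn0; apply: kdim_leq dI kdim0 WE0.
Qed.

Lemma kdim_gt0 n W x : kdim iota W n -> W x -> x != 0 -> (0 < n)%N.
Proof.
case: n => // -[w /kbasis_lc[_ <-]] [c _ <-].
by rewrite /lc big_ord0 eqxx.
Qed.

Lemma kbasis_mem n (v : 'I_n -> L) W i : kbasis iota v W -> W (v i).
Proof. by move=> /kbasis_lc[_ <-]; exists (delta_mx 0 i); rewrite ?lc_delta. Qed.

Lemma kbasis_neq0 n (v : 'I_n -> L) W i : kbasis iota v W -> v i != 0.
Proof.
move=> /kbasis_lc[fv _]; apply/eqP => vi0.
have/rowP/(_ i) : delta_mx 0 i = 0 :> 'rV[K]_n by apply: fv; rewrite lc_delta.
by rewrite !mxE !eqxx => /eqP; rewrite oner_eq0.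
Qed.

Lemma kdim_neq0 n W : kdim iota W n -> (0 < n)%N -> exists2 x, W x & x != 0.
Proof.
case: n => // n [w bw] _.
by exists (w ord0); [apply: kbasis_mem bw|apply: kbasis_neq0 bw].
Qed.

(** * Unmatchability as a statement about products of subspaces *)

(** Turns the matching condition into the vanishing of one coordinate. *)
Lemma kspan_others n (b : 'I_n -> L) i c : kfree iota b ->
  kspan iota [set b j | j in [set j | j != i]] (lc b c) <-> c 0 i = 0.
Proof.
move=> /kfree_lc fb; split=> [|ci].
  pose W := [set x | exists2 d : 'rV[K]_n, d 0 i = 0 & x = lc b d].
  have kW : kspace W.
    split=> [|a _ _ [d di ->] [e ei ->]]; first by exists 0; rewrite ?lc0 ?mxE.
    by exists (a *: d + e); rewrite ?lc_lin // !mxE di ei mulr0 addr0.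
  have bW : [set b j | j in [set j | j != i]] `<=` W.
    move=> _ [j /= ji <-]; exists (delta_mx 0 j); rewrite ?lc_delta //.
    by rewrite mxE eq_sym (negPf ji).
  move=> /(kspan_min kW bW)[d di] /eqP; rewrite -subr_eq0 -lcN -lcD => /eqP/fb/eqP.
  by rewrite subr_eq0 => /eqP->.
have kX := kspace_kspan [set b j | j in [set j | j != i]].
apply: kspace_sum => // j _; have [->|ji] := eqVneq j i.
  by rewrite ci rmorph0 mul0r; case: kX.
by apply: kspaceZ => //; apply: sub_kspan; exists j.
Qed.

Lemma kfree_comp m n (v : 'I_n -> L) (f : 'I_m -> 'I_n) :
  injective f -> kfree iota v -> kfree iota (v \o f).
Proof.
move=> injf /kfree_lc fv; apply/kfree_lc => c c0.
have/rowP vf0 : \sum_k c 0 k *: delta_mx 0 (f k) = 0 :> 'rV[K]_n.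
  by apply: fv; rewrite lc_sum -[RHS]c0; apply: eq_bigr => k _; rewrite lcZ lc_delta.
apply/rowP => k; have := vf0 (f k); rewrite summxE (bigD1 k) //= !mxE !eqxx mulr1.
rewrite big1 ?addr0 // => l lk; rewrite !mxE (inj_eq injf) eq_sym (negPf lk).
by rewrite andbF mulr0.
Qed.

Lemma adapted_basis m r V A : kdim iota V m -> V `<=` A -> kdim iota A (m + r) ->
  exists2 a : 'I_(m + r) -> L, kbasis iota a A & forall i, V (a (lshift r i)).
Proof.
move=> dV VA [e /kbasis_lc[fe defA]]; have [U UP] := preim_kspace e (kdim_kspace dV).
have dU : \dim U = m.
  apply: kdim_uniq dV; rewrite -(image_preim _ UP) ?defA //.
  by apply: kdim_image => c _; apply: fe.
have [X bX] := exists_basis dU.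
have dC : \dim U^C = r by rewrite dimv_compl dimvf dU /dim /= mul1n addKn.
have [Y bY] := exists_basis dC.
have bXY : basis_of {:'rV[K]_(m + r)} [tuple of X ++ Y].
  rewrite -(addv_complf U); apply: cat_basis => //.
  by apply/directv_addP; rewrite capv_compl.
have injf c : c \in {:'rV[K]_(m + r)}%VS -> lc e c = 0 -> c = 0
  by move=> _; apply: fe.
exists (fun i => lc e (tnth [tuple of X ++ Y] i)).
  rewrite -defA; suff <- : lc e @` [set` {:'rV[K]_(m + r)}%VS] = range (lc e).
    exact: kbasis_image injf bXY.
  by congr image; apply/seteqP; split=> // c _; rewrite /= memvf.
by move=> i; apply/UP; rewrite tnth_lshift (basis_mem bX) // mem_tnth.
Qed.

(** Choose a basis of [A] whose first [m] vectors lie in [V]. For each of them [U] is contained in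
    [(a i)^-1 A] and in [B], so for a matched basis [b] the first [m] coordinates vanish on [U].
    Then [U] lies in the span of the last [r] vectors of [b], too small for dimension [u]. *)
Lemma not_matched m r u A B V U :
    kdim iota A (m + r) -> kdim iota V m -> V `<=` A ->
    kdim iota U u -> U `<=` B -> (r < u)%N ->
    (forall x y, V x -> U y -> A (x * y)) ->
  ~ matched iota A B.
Proof.
move=> dA dV VA dU UB ru VU mAB.
have [a ba aV] := adapted_basis dV VA dA.
have [b [[fb defB] mab]] := mAB _ _ ba.
move: defB; rewrite kspan_range => defB.
suff /(kdim_le_range dU) : U `<=` range (lc (b \o @rshift m r)) by lia.
move=> y Uy; have := UB y Uy; rewrite -defB => -[c _ cy].
have c0 i : c 0 (lshift r i) = 0.
  apply/(kspan_others _ _ fb); rewrite cy; apply: mab; split; last exact: UB.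
  exists (a (lshift r i) * y); first exact: VU.
  by rewrite mulrA mulVf ?mul1r //; apply: kbasis_neq0 ba.
exists (rsubmx c) => //; rewrite -cy /lc big_split_ord /= [X in X + _]big1 => [|i _].
  by rewrite add0r; apply: eq_bigr => i _; rewrite mxE.
by rewrite c0 rmorph0 mul0r.
Qed.

(** A matched basis of [B] is one whose [i]-th coordinate vanishes on [(a i)^-1 A] inside [B], so
    [dual_rado] supplies it unless its rank condition fails at some [J]. Then [S] is the span of the
    [a j] with [j] in [J], and [U] the intersection of the corresponding subspaces of [B]. *)
Lemma not_matched_inv n A B : kdim iota A n -> kdim iota B n -> ~ matched iota A B ->
  exists S U s u, [/\ kdim iota S s, kdim iota U u, (0 < s)%N & (n < s + u)%N] /\
    [/\ S `<=` A, U `<=` B & forall x y, S x -> U y -> A (x * y)].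
Proof.
move=> dA dB; apply: contra_notP => noSU n' a ba.
have nn' : n' = n by apply: kdim_uniq dA; exists a.
subst n'; have kA := kdim_kspace dA.
have [e /kbasis_lc[fe defB]] := dB.
(* [W i] is the intersection of [(a i)^-1 A] with [B], in the coordinates of [e]. *)
have /choice[W WP] : forall i, exists U : {vspace 'rV[K]_n},
    forall c, c \in U <-> A (a i * lc e c).
  move=> i.
  apply: (preim_kspace e (W := [set x | A (a i * x)])).
  split=> [|c x y] /=; first by rewrite mulr0; case: kA.
  by rewrite mulrDr mulrCA; case: kA => _; apply.
have dimT : \dim {:'rV[K]_n} = n by rewrite dimvf /dim /= mul1n.
have [|b bb bW] := dual_rado dimT (W := W).
  move=> J; rewrite dimT leqNgt; apply/negP => bigJ; apply: noSU.
  set X := (\bigcap_(j in J) W j)%VS in bigJ.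
  have fJ : kfree iota (a \o (enum_val : 'I_#|J| -> 'I_n)).
    by apply: kfree_comp; [apply: enum_val_inj|case: ba].
  exists (range (lc (a \o (enum_val : 'I_#|J| -> 'I_n)))), (lc e @` [set` X]).
  exists #|J|, (\dim X); split; first split.
  - by eexists; apply/kbasis_lc; split; [apply: (proj1 (kfree_lc _) fJ)|].
  - by apply: kdim_image => c _; apply: fe.
  (* [J] is nonempty because [X] alone has dimension at most [n]. *)
  - by have := dimvS (subvf X); rewrite dimT; lia.
  - by rewrite addnC.
  split=> [_ [c _ <-]|_ [c _ <-]|].
  - by apply: kspace_lc => // i; apply: kbasis_mem ba.
  - by rewrite -defB; exists c.
  move=> _ _ [c _ <-] [d dX <-]; rewrite mulr_suml; apply: kspace_sum => // i _.
  rewrite -mulrA; apply: kspaceZ => //; apply/WP; move: d dX; apply/subvP.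
  by apply: (bigcapv_inf (enum_val i)); rewrite ?enum_valP ?subvv.
have bT : kbasis iota (fun i => lc e (tnth b i)) B.
  rewrite -defB; have <- : lc e @` [set` {:'rV[K]_n}%VS] = range (lc e).
    by congr image; apply/seteqP; split=> // c _; rewrite /= memvf.
  by apply: kbasis_image bb => c _; apply: fe.
exists (fun i => lc e (tnth b i)); split=> // i _ [[x Ax <-]].
rewrite -{1}defB => -[c _ cx]; rewrite -cx.
have -> : lc e c = lc (fun i => lc e (tnth b i)) (\row_j coord b j c).
  rewrite {1}(coord_basis bb (memvf c)) lc_sum; apply: eq_bigr => j _.
  by rewrite lcZ mxE (tnth_nth 0).
apply/kspan_others; first by case: bT.
rewrite mxE; apply/bW/WP; rewrite cx mulrA divff ?mul1r //.
exact: kbasis_neq0 ba.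
Qed.

(** * Intermediate fields and the subspaces they stabilise *)

Lemma intermediate_fieldP F : intermediate_field iota F ->
  [/\ kspace F, F 1, (forall x y, F x -> F y -> F (x * y))
    & (forall x, F x -> F x^-1)].
Proof.
move=> [iF [F1 Fsub Fdiv]].
have F_1 : F 1 by move: F1; rewrite inE.
have FB x y : F x -> F y -> F (x - y).
  by move=> Fx Fy; have := Fsub x y; rewrite !inE; apply.
have FV x : F x -> F x^-1.
  by move=> Fx; have := Fdiv 1 x; rewrite !inE div1r; apply.
have FM x y : F x -> F y -> F (x * y).
  by move=> Fx /FV Fy; have := Fdiv x y^-1; rewrite !inE invrK; apply.
have F0 : F 0 by rewrite -(subrr 1); apply: FB.
split=> //; split=> // c x y Fx Fy; rewrite -[y]opprK; apply: (FB _).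
  by apply: FM => //; apply: iF; exists c.
by rewrite -sub0r; apply: FB.
Qed.

Lemma intermediate_field_base : intermediate_field iota (range iota).
Proof.
split=> //; split=> [|x y|x y]; rewrite ?inE.
- by exists 1; rewrite ?rmorph1.
- by move=> [c _ <-] [d _ <-]; exists (c - d); rewrite ?rmorphB.
- by move=> [c _ <-] [d _ <-]; exists (c / d); rewrite ?fmorph_div.
Qed.

Lemma kdim_base : kdim iota (range iota) 1.
Proof.
exists (fun=> 1); apply/kbasis_lc; split=> [c|].
  rewrite /lc big_ord1 mulr1 => /eqP; rewrite fmorph_eq0 => /eqP c0.
  by apply/rowP => i; rewrite mxE ord1.
apply/seteqP; split=> _ [c _ <-]; first by exists (c 0 0);
  rewrite // /lc big_ord1 mulr1.
by exists c%:M; rewrite // /lc big_ord1 mulr1 mxE eqxx.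
Qed.

(** For an intermediate field [F] and a [K]-subspace [W], this makes [W] an [F]-subspace; in the
    Dyson argument [F] is only a [K]-subspace. *)
Definition stable F W := forall x y, F x -> W y -> W (x * y).

Lemma stable_base W : kspace W -> stable (range iota) W.
Proof. by move=> kW _ y [c _ <-]; apply: kspaceZ. Qed.

(** The sum is direct: a nonzero [x * f] in [W] would give [x] in [W] on multiplying by [f^-1]. With
    [F = range iota] this adjoins a single vector. *)
Lemma stable_adjoin F d W m x : intermediate_field iota F -> kdim iota F d ->
    kdim iota W m -> stable F W -> ~ W x ->
  kdim iota (sumset W (scaleset x F)) (m + d) /\ stable F (sumset W (scaleset x F)).
Proof.
move=> /intermediate_fieldP[kF F1 FM FV] dF dW sW Wx.
have kW := kdim_kspace dW.
have x0 : x != 0 by apply/eqP => x0; apply: Wx; rewrite x0; case: kW.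
split.
  apply: kdim_sum_direct => //; first exact: kdim_scale.
  move=> z [Wz [f Ff zE]]; rewrite -{}zE in Wz *.
  apply: contrapT => /eqP; rewrite mulf_eq0 (negPf x0) => f0.
  by apply: Wx; rewrite -(mulfK f0 x) mulrC; apply: sW => //; apply: FV.
move=> f _ Ff [w [_ [Ww [g Fg <-] ->]]]; exists (f * w), (x * (f * g)); split.
- exact: sW.
- by exists (f * g) => //; apply: FM.
- by rewrite mulrDr [f * (x * g)]mulrCA.
Qed.

(** Starting from 0, adjoin [F]-lines inside [V] until [V] is exhausted; each adds [d] to the
    dimension. *)
Lemma stable_dvdn F d V m : intermediate_field iota F -> kdim iota F d ->
  kdim iota V m -> stable F V -> (d %| m)%N.
Proof.
move=> iF dF dV sV; have [kF F1 _ _] := intermediate_fieldP iF.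
have d0 := kdim_gt0 dF F1 (oner_neq0 L); have kV := kdim_kspace dV.
suff grow W p : kdim iota W p -> W `<=` V -> stable F W -> (d %| p)%N ->
    (d %| m)%N.
  apply: (grow [set 0] 0%N) => //; first exact: kdim0.
    by move=> _ ->; case: kV.
  by move=> x _ _ ->; rewrite /= mulr0.
have [k] := ubnP (m - p)%N; elim: k W p => // k IH W p mp dW WV sW dp.
have [VW|/existsNP[x /not_implyP[Vx Wx]]] := pselect (V `<=` W).
  by rewrite (kdim_uniq dV (n := p)) // (_ : V = W) //; apply/seteqP.
have [dW' sW'] := stable_adjoin iF dF dW sW Wx.
have W'V : sumset W (scaleset x F) `<=` V.
  move=> _ [w [_ [Ww [f Ff <-] ->]]]; apply: (kspaceD kV); first exact: WV.
  by rewrite mulrC; apply: sV.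
have pd := kdim_leq dW' dV W'V.
by apply: IH dW' W'V sW' _; [lia|rewrite dvdn_addl].
Qed.

(** Adjoin [q] lines over [F]; a new vector exists at each stage since the dimension reached is
    still below [[L:K]]. *)
Lemma exists_stable F d n q : intermediate_field iota F -> kdim iota F d ->
  lt_degree iota n -> (q * d <= n)%N -> exists2 V, kdim iota V (q * d) & stable F V.
Proof.
move=> iF dF ltn; have [kF F1 _ _] := intermediate_fieldP iF.
have d0 := kdim_gt0 dF F1 (oner_neq0 L).
elim: q => [|q IH] qd.
  by exists [set 0]; [apply: kdim0|move=> x _ _ ->; rewrite /= mulr0].
have [|V dV sV] := IH; first by lia.
have [x Vx] : exists x, ~ V x.
  apply/existsNP => allV; have := ltn (q * d)%N.
  suff <- : V = setT by move=> /(_ dV); lia.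
  by apply/seteqP; split=> // x _; apply: allV.
have [dV' sV'] := stable_adjoin iF dF dV sV Vx.
by rewrite mulSnr; exists (sumset V (scaleset x F)).
Qed.

(* With [z = 0] this is plain extension to dimension [n]; with [z != 0] the
   extension also avoids [z]. *)
Lemma kdim_extend C W m n z : kspace C -> W `<=` C -> C z -> kdim iota W m ->
    (W z -> z = 0) -> (forall d, kdim iota C d -> (n < d)%N) -> (m <= n)%N ->
  exists W', [/\ W `<=` W', W' `<=` C, kdim iota W' n & W' z -> z = 0].
Proof.
move=> kC WC Cz dW Wz Cn /subnKC; move: (n - m)%N => k.
elim: k m W dW WC Wz => [|k IH] m W dW WC Wz mkn.
  by exists W; rewrite -mkn addn0; split.
have kW := kdim_kspace dW.
have adjoin x : ~ W x -> C x ->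
    kdim iota (sumset W (scaleset x (range iota))) (m + 1) /\
    sumset W (scaleset x (range iota)) `<=` C.
  move=> Wx Cx; split.
    by have [] := stable_adjoin intermediate_field_base kdim_base dW (stable_base kW) Wx.
  move=> _ [w [_ [Ww [_ [c _ <-] <-] ->]]]; apply: kspaceD => //; first exact: WC.
  by rewrite mulrC; apply: kspaceZ.
(* [T] is [W] with [z] adjoined ([W] itself if [z = 0]). Its dimension is at most [n], so [C] has a
   vector outside it, and adding that vector to [W] cannot capture a nonzero [z]. *)
have [T [t [dT tm WT Tz TC]]] : exists T t,
    [/\ kdim iota T t, (t <= m + 1)%N, W `<=` T, T z & T `<=` C].
  have [z0|/eqP z0] := eqVneq z 0.
    by exists W, m; split=> //; [rewrite leq_addr|rewrite z0; case: kW].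
  have nWz : ~ W z by move=> /Wz.
  have [dT TC] := adjoin z nWz Cz.
  exists (sumset W (scaleset z (range iota))), (m + 1)%N; split=> //.
    apply: sumset_subl; apply: kdim_kspace (kdim_scale _ kdim_base); exact/eqP.
  apply: sumset_subr => //; exists 1; rewrite ?mulr1 //; exists 1; rewrite ?rmorph1 //.
have [x Cx Tx] : exists2 x, C x & ~ T x.
  apply: contrapT => noX; have := Cn t; suff <- : T = C by move=> /(_ dT); lia.
  by apply/seteqP; split=> // x Cx; apply: contrapT => Tx; apply: noX; exists x.
have Wx : ~ W x by move=> /WT.
have [dW' W'C] := adjoin x Wx Cx.
have W'z : sumset W (scaleset x (range iota)) z -> z = 0.
  move=> [w [_ [Ww [_ [c _ <-] <-] zE]]]; have [c0|c0] := eqVneq c 0.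
    by apply: Wz; rewrite zE c0 rmorph0 mulr0 addr0.
  case: Tx; have kT := kdim_kspace dT.
  have -> : x = iota c^-1 * (z - w).
    by rewrite zE addrC addKr mulrCA -rmorphM mulVf // rmorph1 mulr1.
  by apply: kspaceZ => //; apply: kspaceB => //; apply: WT.
have [|W'' [W'W'' W''C dW'' W''z]] := IH _ _ dW' W'C W'z; first by lia.
exists W''; split=> //.
apply: subset_trans W'W''; apply: sumset_subl.
apply: (kdim_kspace (n := 1)); apply: kdim_scale kdim_base; apply/eqP => x0.
by apply: Wx; rewrite x0; case: kW.
Qed.

(** * Dyson transforms and stabilisers *)

(* Dyson's transform [S, U |-> S + eU, U /\ e^-1 S], e in S, keeps dim S + dim U
   and the products inside A; it strictly decreases U unless eU <= S. *)
Lemma dyson A S U s u : kspace A -> kdim iota S s -> kdim iota U u -> U 1 ->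
    (0 < s)%N -> (forall x y, S x -> U y -> A (x * y)) ->
  exists V W v w,
    [/\ kdim iota V v, kdim iota W w, V `<=` A, (0 < v)%N & (s + u <= v + w)%N]
    /\ stable W V.
Proof.
move=> kA; have [k] := ubnP u; elim: k u s S U => // k IH u s S U uk dS dU U1 s0 SU.
(* Terminal case: [U] stabilises [S], and [S] lies in [A] because 1 is in [U]. *)
have [sU|] := pselect (forall e x, S e -> U x -> S (e * x)).
  exists S, U, s, u; split; last by move=> x y Ux Sy; rewrite mulrC; apply: sU.
  by split=> // x Sx; rewrite -[x]mulr1; apply: SU.
move=> /existsNP[e /existsNP[x /not_implyP[Se /not_implyP[Ux Sex]]]].
have kS := kdim_kspace dS; have kU := kdim_kspace dU.
have e0 : e != 0.
  by apply/eqP => e0; apply: Sex; rewrite e0 mul0r; case: kS.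
have [s' [t [dS' dI st]]] := kdim_sumI dS (kdim_scale e0 dU).
pose U' := [set y | U y /\ S (e * y)].
have dU' : kdim iota U' t.
  have -> : U' = scaleset e^-1 (S `&` scaleset e U).
    apply/seteqP; split=> [y [Uy Sy]|_ [z [Sz [y Uy yE]] <-]].
      by exists (e * y); rewrite ?mulKf //; split=> //; exists y.
    by rewrite -{}yE in Sz *; rewrite mulKf.
  by apply: kdim_scale => //; rewrite invr_eq0.
have U'U : U' `<=` U by move=> y [].
(* The vector [x] of [U] with [e * x] outside [S] is lost in [U']. *)
have tu : (t < u)%N.
  rewrite ltn_neqAle (kdim_leq dU' dU U'U) andbT; apply/eqP => tu.
  rewrite tu in dU'; apply: Sex.
  by move: Ux; rewrite -(kdim_eq dU' dU U'U) => -[].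
have SS' : (s <= s')%N.
  apply: kdim_leq dS dS' _; apply: sumset_subl.
  by apply: (kdim_kspace (n := u)); apply: kdim_scale.
have [| | | |V [W [v [w [[dV dW VA v0 svw] sV]]]]] := IH t s' _ U' _ dS' dU'.
- lia.
- by split; rewrite ?mulr1.
- lia.
(* [(z + e z') y = z y + (e y) z'], and [e y] is in [S] by the choice of [U'], so both terms are
   products of [S] and [U]. *)
- move=> _ y [z [_ [Sz [z' Uz' <-] ->]]] [Uy Sey]; rewrite mulrDl.
  by apply: kspaceD => //; [apply: SU|rewrite mulrAC; apply: SU].
by exists V, W, v, w; split=> //; split=> //; lia.
Qed.

(** Evaluation at a nonzero [y] of [V] embeds the stabiliser into [y^-1 V], so it has finite
    dimension. A nonzero [x] in it satisfies [x V = V] by dimension, which gives inverses. *)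
Lemma stabilizer V v : kdim iota V v -> (0 < v)%N ->
  exists h, intermediate_field iota [set x | forall y, V y -> V (x * y)] /\
    kdim iota [set x | forall y, V y -> V (x * y)] h.
Proof.
move=> dV v0; set H := [set x | _].
have kV := kdim_kspace dV; have [y Vy y0] := kdim_neq0 dV v0.
have kH : kspace H.
  split=> [z Vz|c x x' Hx Hx' z Vz]; first by rewrite mul0r; case: kV.
  by rewrite mulrDl -mulrA; case: kV => _; apply; [apply: Hx|apply: Hx'].
have [|h dH] := kspace_sub_kdim kH (kdim_scale (invr_neq0 y0) dV).
  by move=> x /(_ y Vy) Vxy; exists (x * y); rewrite // mulrC mulfK.
have HV x : H x -> H x^-1.
  move=> Hx; have [->|x0] := eqVneq x 0; first by rewrite invr0; case: kH.
  have VE : scaleset x V = V.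
    by apply: kdim_eq (kdim_scale x0 dV) dV _ => _ [z Vz <-]; apply: Hx.
  by move=> z; rewrite -{1}VE => -[z' Vz' <-]; rewrite mulKf.
exists h; split=> //; split=> [_ [c _ <-] z Vz|]; first exact: kspaceZ.
split=> [|x x'|x x']; rewrite ?inE; first by move=> z; rewrite mul1r.
  exact: kspaceB.
by move=> Hx /HV Hx' z Vz; rewrite -mulrA; apply/Hx/Hx'.
Qed.

End Subspaces.

(** * Unmatchable pairs and the degrees of intermediate fields *)

Theorem theorem3p10 (K L : fieldType) (iota : {rmorphism K -> L})
    (properKL : range iota `<` [set: L])
    (exF : exists F : set L,
       [/\ intermediate_field iota F, range iota `<` F, F `<` [set: L]
         & exists d, kdim iota F d])
    (n : nat) (n_gt0 : (0 < n)%N)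
    (le_n0_n : (n0 iota <= n)%N) (lt_n_deg : lt_degree iota n) :
  (exists A B : set L,
     [/\ kdim iota A n, kdim iota B n, ~ B 1 & ~ matched iota A B])
  <->
  (exists (F : set L) (d : nat),
     [/\ intermediate_field iota F, range iota `<` F, kdim iota F d,
         (d <= n)%N & ~~ (d %| n.+1)%N]).
Proof.
split=> [[A [B [dA dB B1]]]|[F [d [iF _ dF dn ndvd]]]].
  apply: contra_notP => noF.
  have {noF} dvdF F d : intermediate_field iota F -> range iota `<` F ->
      kdim iota F d -> (d <= n)%N -> (d %| n.+1)%N.
    move=> iF KF dF dn; apply: contrapT => /negP ndvd; apply: noF.
    by exists F, d.
  apply: contrapT => /(not_matched_inv dA dB).
  move=> [S [U [s [u [[dS dU s0 su] [SA UB SU]]]]]].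
  have kA := kdim_kspace dA; have kU := kdim_kspace dU.
  have U1 : ~ U 1 by move=> /UB.
  (* Since 1 is not in [B], adjoining it to [U] gains a dimension: [s + (u + 1)] is at least
     [n + 2]. Products stay in [A] because [S] does. *)
  have [dU1 _] := stable_adjoin (intermediate_field_base iota) (kdim_base iota)
    dU (stable_base kU) U1.
  set U' := sumset _ _ in dU1.
  have U'1 : U' 1.
    apply: (sumset_subr kU); exists 1; last exact: mulr1.
    by exists 1; rewrite ?rmorph1.
  have SU' x y : S x -> U' y -> A (x * y).
    move=> Sx [z [_ [Uz [_ [c _ <-] <-] ->]]].
    rewrite mulrDr mul1r [x * iota c]mulrC.
    by apply: (kspaceD kA); [apply: SU|apply: (kspaceZ c kA); apply: SA].
  have [V [W [v [w [[dV dW VA v0 svw] sV]]]]] := dyson kA dS dU1 U'1 s0 SU'.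
  have [h [iH dH]] := stabilizer dV v0.
  have wh : (w <= h)%N by apply: kdim_leq dW dH _ => x Wx y Vy; apply: sV.
  have vn : (v <= n)%N := kdim_leq dV dA VA.
  have hv : (h %| v)%N by apply: stable_dvdn iH dH dV _ => x y Hx; apply: Hx.
  have hn : (h %| n.+1)%N.
    apply: dvdF (iH) _ (dH) _; last by apply: leq_trans vn; apply: dvdn_leq.
    (* If the stabiliser were the base field, then [w <= h <= 1] and [v + w <= n + 1], one short of
       [n + 2]. *)
    split; first by case: iH.
    by move=> /(kdim_leq dH (kdim_base iota)); lia.
  (* As [v <= n], the difference is positive, so [h <= n + 1 - v]; yet [v + h >= v + w >= n + 2]. *)
  have : (h %| n.+1 - v)%N by rewrite dvdn_sub.
  by move=> /dvdn_leq; lia.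
have [kF F1 _ _] := intermediate_fieldP iF.
have d0 := kdim_gt0 dF F1 (oner_neq0 L).
have kT : kspace iota [set: L] by [].
have oneU U : (U 1 -> 1 = 0 :> L) -> ~ U 1.
  by move=> U1 /U1/eqP; rewrite oner_eq0.
(* [U] is a complement of the base field in [F]: dimension [d - 1], avoiding [z = 1]. *)
have [U [_ UF dU U1]] : exists U : set L,
    [/\ [set 0] `<=` U, U `<=` F, kdim iota U d.-1 & U 1 -> 1 = 0 :> L].
  apply: kdim_extend (kdim0 iota) _ _ _ => //.
  - by move=> _ ->; case: kF.
  - by move=> d' dF'; rewrite (kdim_uniq dF' dF); lia.
have [B [UB _ dB B1]] : exists B : set L,
    [/\ U `<=` B, B `<=` setT, kdim iota B n & B 1 -> 1 = 0 :> L].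
  by apply: kdim_extend dU _ _ _ => //; lia.
have [V dV sV] := exists_stable iF dF lt_n_deg (leq_divM n d).
have [A [VA _ dA _]] : exists A : set L,
    [/\ V `<=` A, A `<=` setT, kdim iota A n & A 0 -> 0 = 0 :> L].
  by apply: kdim_extend dV _ _ _ => //; apply: leq_divM.
exists A, B; split=> //; first exact: oneU.
(* With [r = n %% d], the inequality required is [r < d - 1]; the remaining value [r = d - 1] would
   make [d] divide [n + 1]. *)
rewrite (divn_eq n d) in dA; apply: (not_matched dA dV VA dU UB).
  have := ltn_pmod n d0; move: ndvd; rewrite {1}(divn_eq n d) -addnS.
  rewrite dvdn_addr ?dvdn_mull // => ndvd rd.
  have : (n %% d).+1 != d by apply: contraNneq ndvd => ->.
  lia.
by move=> x y Vx Uy; apply: VA; rewrite mulrC; apply: sV => //; apply: UF.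
Qed.
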